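(* Let $D\in\mathbb{N}$, $D\ge2$, and let $p>D$. Consider the lattice graph $\mathbb{Z}^D$ with counting measure and unit edge weights. For every $\beta<p-D$ and every $C_*>0$, there exists $R_0=R_0(\beta,C_*,p,D)>1$ such that, for every $R\in\mathbb{N}$ with $R\ge R_0$, one can find a nonnegative potential $w_R:B(0,R)\to[0,\infty)$ and a nontrivial (i.e. not identically zero) solution $u_R\in X_{\mathbb{Z}^D}(B(0,R))$ of $$-\Delta_p^\omega u_R(x)=w_R(x)|u_R(x)|^{p-2}u_R(x)\quad (x\in B(0,R)),\qquad u_R(x)=0\quad (x\in\mathbb{Z}^D\setminus B(0,R)),$$ such that $$\|w_R\|_{\ell^1(B(0,R),\mu)}<\frac{C_*}{r_{B(0,R)}^{\beta}}.$$
   Context: The lattice graph has vertex set $\mathbb{Z}^D$, with $x\sim y$ iff $|x-y|_1=\sum_{i=1}^D|x_i-y_i|=1$; $\mu(x)=1$ for all $x$; $\omega_{xy}=1$ if $x\sim y$ and $\omega_{xy}=0$ otherwise. The graph distance is $d(x,y)=|x-y|_1$, and $B(0,R)=\{y\in\mathbb{Z}^D:|y|_1\le R\}$. For a nonempty finite $\Omega\subset\mathbb{Z}^D$, $X_{\mathbb{Z}^D}(\Omega)=\{u:\mathbb{Z}^D\to\mathbb{R}:u=0\text{ in }\mathbb{Z}^D\setminus\Omega\}$, and the inner radius is $r_\Omega=\sup_{x\in\Omega}\inf_{y\in\mathbb{Z}^D\setminus\Omega}d(x,y)$. The discrete $p$-Laplacian is here $\Delta_p^\omega u(x)=\sum_{y\sim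 x}|u(y)-u(x)|^{p-2}(u(y)-u(x))$. Also $\|w\|_{\ell^1(\Omega,\mu)}=\sum_{x\in\Omega}|w(x)|$. $\mathbb{N}$ denotes the positive integers. *)

(* Defs.v *)
From HB Require Import structures.
From mathcomp Require Import all_boot all_order all_algebra.
From mathcomp Require Import all_classical all_reals all_analysis.

Set Implicit Arguments.
Unset Strict Implicit.
Unset Printing Implicit Defensive.

Import Order.TTheory GRing.Theory Num.Theory.

Local Open Scope classical_set_scope.
Local Open Scope ring_scope.

Definition l1norm (D : nat) (x : 'rV[int]_D) : nat :=
  (\sum_(i < D) `|x ord0 i|)%N.

Definition l1dist (D : nat) (x y : 'rV[int]_D) : nat := l1norm (x - y).

Definition lattice_adj (D : nat) (x y : 'rV[int]_D) : Prop :=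
  l1dist x y = 1%N.

Definition lattice_ball (D n : nat) : set 'rV[int]_D :=
  [set y | (l1norm y <= n)%N].

Arguments lattice_ball : clear implicits.

(* The real-valued [sup] and [inf] are meaningful when [Omega] is nonempty and
   finite and [0 < D]: the sets involved are then nonempty and bounded. *)
Definition inner_radius (R : realType) (D : nat) (Omega : set 'rV[int]_D) : R :=
  sup [set inf [set (l1dist x y)%:R | y in ~` Omega] | x in Omega].

Definition zero_outside (R : realType) (D : nat) (Omega : set 'rV[int]_D)
    (u : 'rV[int]_D -> R) : Prop :=
  forall x, (~` Omega) x -> u x = 0.

Definition pLaplacian (R : realType) (D : nat) (p : R)
    (u : 'rV[int]_D -> R) (x : 'rV[int]_D) : R :=
  \sum_(y \in [set y | lattice_adj x y])
    (`|u y - u x| `^ (p - 2)) * (u y - u x).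

Definition l1_on (R : realType) (D : nat) (Omega : set 'rV[int]_D)
    (w : 'rV[int]_D -> R) : R :=
  \sum_(x \in Omega) `|w x|.

(* The potential [w] is represented by a total function of which only the
   values on [Omega] matter. *)
Definition dirichlet_solution (R : realType) (D : nat) (p : R)
    (Omega : set 'rV[int]_D) (w u : 'rV[int]_D -> R) : Prop :=
  (forall x, Omega x ->
     - pLaplacian p u x = w x * (`|u x| `^ (p - 2)) * u x) /\
  zero_outside Omega u.

(* Main.v *)
Require Import Defs.
From HB Require Import structures.
From mathcomp Require Import all_boot all_order all_algebra.
From mathcomp Require Import all_classical all_reals all_analysis.
From mathcomp Require Import zify ring lra.

Import Order.TTheory GRing.Theory Num.Theory.
Import numFieldNormedType.Exports.

Local Open Scope classical_set_scope.
Local Open Scope ring_scope.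

(** The potential is a point mass at the origin, and the solution [u] is the
equilibrium potential of the origin in the ball: [u 0 = 1], [u = 0] outside the
ball [B(0, n)], and [u] is p-harmonic at every other point of the ball.  For
such a [u] the equation holds with [w = M * delta_0], where
[M = - Delta_p u 0], and [M >= 0] because [u] is maximal at the origin.  The
l1-norm of [w] is [M], which is the p-capacity of the origin.  When [p > D] a
point has small capacity in a large ball: the tent function
[1 - |x|_1 / (n + 1)] has slopes [1 / (n + 1)] on about [n ^ D] edges, hence
energy of order [n ^ (D - p)].  Since [B(0, n)] has inner radius [n + 1] and
[beta < p - D], this beats [C / (n + 1) ^ beta] for large [n].

Three lemmas carry the argument.  [perron_solution] produces [u] as a supremum
of subsolutions, using only that the flux [t |-> |t| ^ (p - 2) * t] is monotone,
continuous and zero at 0; no energy is minimised.  [green_identity], a summation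
by parts on the lattice, writes [M] both as the energy of [u] (testing against
[u]) and as the pairing of the flux of [u] with the gradient of the tent
(testing against the tent).  [flux_young] bounds this pairing by half of the
energy of [u] plus a multiple of the energy of the tent, so that [M] is at most
a constant times the latter; this is [flux_at_pole_le]. *)

(** * The scalar flux *)

Definition flux {R : realType} (p t : R) : R := `|t| `^ (p - 2) * t.

Lemma flux0 (R : realType) (p : R) : flux p 0 = 0.
Proof. by rewrite /flux mulr0. Qed.

Lemma fluxN (R : realType) (p t : R) : flux p (- t) = - flux p t.
Proof. by rewrite /flux normrN mulrN. Qed.

Lemma flux_mul_self (R : realType) (p : R) (p_gt2 : 2 < p) (t : R) :
  flux p t * t = `|t| `^ p.
Proof.
have [->|t0] := eqVneq t 0.
  by rewrite mulr0 normr0 powR0// gt_eqF//; lra.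
rewrite /flux -mulrA -expr2 -real_normK ?num_real// -powR_mulrn//.
by rewrite -powRD ?subrK// normr_eq0 t0 implybT.
Qed.

Lemma ge0_flux_le (R : realType) (p : R) (p_gt2 : 2 < p) (s t : R) :
  0 <= s -> s <= t -> flux p s <= flux p t.
Proof.
move=> s0 st; have t0 := le_trans s0 st.
rewrite /flux !ger0_norm// ler_pM ?powR_ge0//.
by apply: ge0_ler_powR; rewrite ?nnegrE//; lra.
Qed.

Lemma flux_le (R : realType) (p : R) (p_gt2 : 2 < p) (s t : R) :
  s <= t -> flux p s <= flux p t.
Proof.
move=> st; have [s0|s0] := leP 0 s; first exact: ge0_flux_le.
have [t0|t0] := leP 0 t; last first.
  by rewrite -lerN2 -!fluxN ge0_flux_le ?lerN2// oppr_ge0 ltW.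
apply: (@le_trans _ _ 0).
  by rewrite /flux mulr_ge0_le0 ?powR_ge0// ltW.
by rewrite /flux mulr_ge0 ?powR_ge0.
Qed.

(** Away from 0 the power is differentiable; at 0 the flux is squeezed, since
    [|flux p s| <= |s|] as soon as [|s| <= 1]. *)
Lemma flux_continuous (R : realType) (p : R) (p_gt2 : 2 < p) :
  continuous (flux p).
Proof.
move=> t; have [->|t0] := eqVneq t 0; last first.
  apply: cvgM; last exact: cvg_id.
  apply: (@continuous_comp _ _ _ (fun s : R => `|s|) (fun a : R => a `^ (p - 2))).
    exact: norm_continuous.
  apply: differentiable_continuous; apply/derivable1_diffP.
  by apply: derivable_powR; rewrite in_itv/= andbT normr_gt0.
rewrite /continuous_at flux0; apply: norm_cvg0.
apply: (@squeeze_cvgr _ _ _ _ (fun=> 0) (fun s : R => `|s|)).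
- near=> s; rewrite normr_ge0 /= /flux normrM.
  rewrite ger0_norm ?powR_ge0// ler_piMl//.
  have s1 : `|s| <= 1.
    near: s; apply/nbhs_ballP; exists 1 => //= s; rewrite /ball/= sub0r normrN.
    exact: ltW.
  apply: (@le_trans _ _ (1 `^ (p - 2))); last by rewrite powR1.
  apply: ge0_ler_powR; rewrite ?nnegrE//.
  lra.
- exact: cvg_cst.
- by rewrite -[X in _ --> X](@normr0 _ R); exact: norm_continuous.
Unshelve. all: by end_near. Qed.

(** A Young inequality with crude constants: either [2 |b| <= |a|], and the
    first term suffices, or [|a| < 2 |b|], and the second one does.  The factor
    1/2 lets the energy of the solution be absorbed in [flux_at_pole_le]. *)
Lemma flux_young (R : realType) (p : R) (p_gt2 : 2 < p) (a b : R) :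
  flux p a * b <= flux p a * a / 2 + (2 * `|b|) `^ p.
Proof.
rewrite flux_mul_self//.
have fab : flux p a * b <= `|a| `^ (p - 1) * `|b|.
  apply: (le_trans (ler_norm _)); rewrite /flux !normrM.
  rewrite (ger0_norm (powR_ge0 _ _)) ler_wpM2r//.
  rewrite -[p - 2](_ : p - 1 - 1 = _); last by ring.
  by rewrite mulrC mulr_powRB1//; lra.
apply: (le_trans fab).
have pp x : 0 <= x -> x `^ (p - 1) * x = x `^ p.
  by move=> x0; rewrite mulrC mulr_powRB1//; lra.
have [ab|ab] := leP (2 * `|b|) `|a|.
  apply: (@le_trans _ _ (`|a| `^ p / 2)); last by rewrite lerDl powR_ge0.
  rewrite -pp// -mulrA ler_wpM2l ?powR_ge0//; lra.
apply: (@le_trans _ _ ((2 * `|b|) `^ p)); last first.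
  by rewrite lerDr divr_ge0 ?powR_ge0.
rewrite -(pp (2 * `|b|)) ?mulr_ge0//.
apply: ler_pM; rewrite ?powR_ge0//; last by have := normr_ge0 b; lra.
by apply: ge0_ler_powR; rewrite ?nnegrE ?mulr_ge0//; [lra|exact: ltW].
Qed.

(** * The Dirichlet problem with a pole *)

(** Perron's method.  The solution is the pointwise supremum of the
    subsolutions with values in [[0, 1]] that equal 1 at [a] and 0 off [B].
    Increasing the values at the neighbours only increases the sum at [x], so
    the supremum is again a subsolution, by continuity in the value at [x]
    itself.  If the sum at [x] were positive, then [u x] could be raised a little
    without leaving the class, which contradicts maximality. *)
Lemma perron_solution (R : realType) (V : eqType) (N : finType)
    (nbr : N -> V -> V) (f : R -> R) (B : set V) (a : V) :
    {homo f : s t / s <= t} -> f 0 = 0 -> continuous f -> B a ->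
  exists u : V -> R, [/\ forall x, 0 <= u x <= 1, u a = 1,
    forall x, (~` B) x -> u x = 0
    & forall x, B x -> x != a -> \sum_k f (u (nbr k x) - u x) = 0].
Proof.
move=> f_homo f0 f_cont Ba.
pose L (v : V -> R) x t := \sum_k f (v (nbr k x) - t).
pose S := [set v : V -> R | [/\ forall x, 0 <= v x <= 1, v a = 1,
  forall x, (~` B) x -> v x = 0 & forall x, B x -> x != a -> 0 <= L v x (v x)]].
have L_cont v x : continuous (L v x).
  rewrite /L; apply: continuous_big => [|k _ t]; first exact: add_continuous.
  apply: (@continuous_comp _ _ _ (fun t => v (nbr k x) - t) f).
    by apply: cvgB; [exact: cvg_cst|exact: cvg_id].
  exact: f_cont.
have S0 : S (fun x => (x == a)%:R).
  split=> [x||x|x _ /negPf xa].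
  - by case: (x == a); rewrite ler01 lexx.
  - by rewrite eqxx.
  - by move=> nBx; case: eqP => // xa; case: nBx; rewrite xa.
  - by rewrite /L; apply: sumr_ge0 => k _; rewrite xa subr0 -[leLHS]f0 f_homo//.
pose E x := [set v x | v in S].
have E_sup x : has_sup (E x).
  split; first by exists ((x == a)%:R); exists (fun x => (x == a)%:R).
  by exists 1 => _ [v [v01 _ _ _] <-]; case/andP: (v01 x).
pose u x := sup (E x).
have le_u v x : S v -> v x <= u x.
  by move=> Sv; apply: ub_le_sup; [case: (E_sup x)|exists v].
have u_le x c : (forall v, S v -> v x <= c) -> u x <= c.
  move=> vc; apply: ge_sup; first by case: (E_sup x).
  by move=> _ [v Sv <-]; exact: vc.
have u01 x : 0 <= u x <= 1.
  apply/andP; split; first by apply: le_trans (le_u _ x S0); rewrite ler0n.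
  by apply: u_le => v [v01 _ _ _]; case/andP: (v01 x).
have ua : u a = 1.
  apply/le_anti; case/andP: (u01 a) => _ -> /=.
  by apply: le_trans (le_u _ a S0); rewrite eqxx.
have uB x : (~` B) x -> u x = 0.
  move=> nBx; apply/le_anti; case/andP: (u01 x) => -> _; rewrite andbT.
  by apply: u_le => v [_ _ vB _]; rewrite vB.
have L_homo v v' x t : (forall y, v y <= v' y) -> L v x t <= L v' x t.
  by move=> vv'; apply: ler_sum => k _; rewrite f_homo// lerD2r.
(* Otherwise the sum would be negative at all values near [u x], in particular
   at the value [v x] of some subsolution [v]. *)
have Lu_ge0 x : B x -> x != a -> 0 <= L u x (u x).
  move=> Bx xa; rewrite leNgt; apply/negP => Lu_lt0.
  have /nbhs_ballP[e /= e0 eL] : \forall t \near u x, L u x t < 0.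
    exact: (cvgr_lt _ (L_cont u x (u x))).
  have /(sup_adherent e0)[_ [v Sv <-]] := E_sup x => uv.
  have /eL : ball (u x) e (v x).
    by rewrite /ball/= ger0_norm ?subr_ge0 ?le_u// ltrBlDl -ltrBlDr.
  apply/negP; rewrite -leNgt; have [_ _ _ /(_ x Bx xa) Lv] := Sv.
  by apply: le_trans Lv _; apply: L_homo => y; exact: le_u.
exists u; split=> // x Bx xa; apply/le_anti; rewrite [X in _ && X]Lu_ge0// andbT.
rewrite leNgt; apply/negP => Lu_gt0.
have /nbhs_ballP[e /= e0 eL] : \forall t \near u x, 0 < L u x t.
  exact: (cvgr_gt _ (L_cont u x (u x))).
pose t := u x + e / 2.
have Lt : 0 < L u x t.
  by apply: eL; rewrite /ball/= /t opprD addNKr normrN gtr0_norm; lra.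
have ut : u x < t by rewrite /t; lra.
(* A value above 1 would exceed all neighbours and make the sum nonpositive. *)
have t1 : t <= 1.
  rewrite leNgt; apply/negP => t1; move: Lt; apply/negP; rewrite -leNgt.
  apply: sumr_le0 => k _; rewrite -[leRHS]f0 f_homo//.
  by case/andP: (u01 (nbr k x)) => _ u1; lra.
pose v y := if y == x then t else u y.
have uv y : u y <= v y by rewrite /v; case: eqP => // ->; exact: ltW.
suff /(le_u _ x) : S v by rewrite /v eqxx leNgt ut.
split=> [y||y nBy|y By ya].
- rewrite /v; case: eqP => // _; rewrite t1 andbT.
  by case/andP: (u01 x) => u0 _; lra.
- by rewrite /v eq_sym (negPf xa).
- by rewrite /v; case: eqP => [yx|_]; [case: nBy; rewrite yx|exact: uB].
- apply: (@le_trans _ _ (L u y (v y))); last exact: L_homo.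
  by rewrite {1}/v; case: eqP => [->|_]; [exact: ltW|exact: Lu_ge0].
Qed.

(** * The lattice and its balls *)

(** The neighbours of [x] are the [x + lattice_step D k]; the boolean is the
    orientation of the step. *)
Definition lattice_step (D : nat) (k : 'I_D * bool) : 'rV[int]_D :=
  if k.2 then delta_mx 0 k.1 else - delta_mx 0 k.1.

Lemma l1normN (D : nat) (x : 'rV[int]_D) : l1norm (- x) = l1norm x.
Proof. by rewrite /l1norm; apply: eq_bigr => i _; rewrite mxE abszN. Qed.

Lemma l1norm0 (D : nat) : l1norm (0 : 'rV[int]_D) = 0%N.
Proof. by rewrite /l1norm big1// => i _; rewrite mxE. Qed.

Lemma l1normD (D : nat) (x y : 'rV[int]_D) :
  (l1norm (x + y) <= l1norm x + l1norm y)%N.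
Proof.
rewrite /l1norm -big_split; apply: leq_sum => i _; rewrite mxE /=; lia.
Qed.

Lemma l1norm_delta (D : nat) (i : 'I_D) (c : int) :
  l1norm (c *: delta_mx 0 i) = `|c|%N.
Proof.
rewrite /l1norm (bigD1 i)//= big1 => [|j /negPf ji].
  by rewrite !mxE !eqxx mulr1 addn0.
by rewrite !mxE ji andbF mulr0.
Qed.

Lemma l1norm_step (D : nat) (k : 'I_D * bool) : l1norm (lattice_step D k) = 1%N.
Proof.
case: k => i []; rewrite /lattice_step /= ?l1normN.
  by rewrite -[delta_mx _ _]scale1r l1norm_delta.
by rewrite -[delta_mx _ _]scale1r l1norm_delta.
Qed.

Lemma l1norm_eq1 (D : nat) (x : 'rV[int]_D) :
  l1norm x = 1%N -> exists k, x = lattice_step D k.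
Proof.
move=> /eqP /sum_nat_eq1[i [_ xi xj]].
have x0i : `|x 0%R i|%N = 1%N := xi.
exists (i, x 0 i == 1); apply/rowP => j; rewrite /lattice_step /=.
have [->|ji] := eqVneq j i.
  by case: eqP => [->|xi1]; rewrite !mxE !eqxx //=; lia.
have : `|x 0%R j|%N = 0%N := xj j ji erefl.
by case: (_ == 1); rewrite !mxE (negPf ji) andbF /=; lia.
Qed.

Lemma lattice_step_inj (D : nat) : injective (lattice_step D).
Proof.
move=> [i b] [j c] /rowP /[dup] /(_ i) + /(_ j).
have [<-|ij] := eqVneq i j.
  by case: b; case: c => //=; rewrite !mxE !eqxx.
by case: b; case: c; rewrite /lattice_step /= !mxE !eqxx (negPf ij) /=.
Qed.

Lemma pLaplacianE (R : realType) (D : nat) (p : R) (u : 'rV[int]_D -> R) x :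
  pLaplacian p u x =
  \sum_k flux p (u (x + lattice_step D k) - u x).
Proof.
have inj : injective (fun k => x + lattice_step D k).
  by move=> k l /addrI /lattice_step_inj.
rewrite /pLaplacian.
have -> : [set y | lattice_adj x y] =
    [set` [seq x + lattice_step D k | k <- index_enum ('I_D * bool)%type]].
  apply/seteqP; split=> y /=; rewrite /lattice_adj /l1dist.
    rewrite -l1normN opprB => /l1norm_eq1[k yx]; apply/mapP; exists k.
      by rewrite mem_index_enum.
    by rewrite -yx addrC subrK.
  by case/mapP => k _ ->; rewrite opprD addNKr l1normN l1norm_step.
by rewrite -fsbig_seq ?map_inj_uniq ?index_enum_uniq// big_map.
Qed.

(** The points of the cube of side [2 n + 1] centred at the origin; the shift by
    [n] makes its index type finite. *)
Definition box_point (D n : nat) (z : {ffun 'I_D -> 'I_(2 * n).+1}) :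
  'rV[int]_D := \row_i ((z i)%:Z - n%:Z).

Lemma lattice_ball_box (D n : nat) :
  lattice_ball D n `<=` [set` [seq box_point D n z |
              z <- enum {ffun 'I_D -> 'I_(2 * n).+1}]].
Proof.
move=> x /= xn; apply/mapP.
have xi i : (`|x 0%R i| <= n)%N.
  by apply: leq_trans xn; rewrite /l1norm (bigD1 i)//= leq_addr.
exists [ffun i => inord `|(x 0 i + n%:Z)%R|%N]; first by rewrite mem_enum.
apply/rowP => i; rewrite mxE ffunE inordK; move: (xi i); move: (x 0 i) => t; lia.
Qed.

Lemma finite_lattice_ball (D n : nat) : finite_set (lattice_ball D n).
Proof. exact: sub_finite_set (@lattice_ball_box D n) (finite_seq _). Qed.

Lemma sum_lattice_ball_le (R : realType) (D n : nat) (c : R) : 0 <= c ->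
  \sum_(x \in lattice_ball D n) c <= (2 * n).+1%:R ^+ D * c.
Proof.
move=> c0; have ball_fin := @finite_lattice_ball D n; rewrite fsbig_finite//.
rewrite big_const_seq count_predT iter_addr_0 -[c *+ _]mulr_natl -natrX.
apply: ler_wpM2r => //; rewrite ler_nat.
have -> : ((2 * n).+1 ^ D)%N =
    size [seq box_point D n z | z <- enum {ffun 'I_D -> 'I_(2 * n).+1}].
  by rewrite size_map -cardE card_ffun !card_ord.
apply: uniq_leq_size => [|x]; first exact: finmap.fset_uniq.
by rewrite in_fset_set// => /set_mem /lattice_ball_box.
Qed.

(** Moving a point by [n + 1] along one axis, away from the origin, leaves the
    ball; at the centre no shorter displacement does. *)
Lemma inner_radius_lattice_ball (R : realType) (D n : nat) : (0 < D)%N ->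
  inner_radius R (lattice_ball D n) = n.+1%:R.
Proof.
move=> D0; pose i0 := Ordinal D0.
pose dist (x : 'rV[int]_D) : set R :=
  [set (l1dist x y)%:R | y in ~` lattice_ball D n].
have far (x : 'rV[int]_D) :
    exists2 y, (~` lattice_ball D n) y & l1dist x y = n.+1.
  pose c := if 0 <= x ord0 i0 then n.+1%:Z else - n.+1%:Z.
  have cn : `|c|%N = n.+1 by rewrite /c; case: ifP; lia.
  exists (x + c *: delta_mx 0 i0); last first.
    by rewrite /l1dist opprD addNKr l1normN l1norm_delta.
  rewrite /lattice_ball /=; apply/negP; rewrite -ltnNge.
  rewrite /l1norm (bigD1 i0)//=; apply: leq_trans (leq_addr _ _).
  by rewrite !mxE eqxx mulr1 /c; move: (x _ _) => t; case: ifP; lia.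
have dist_lb x : has_lbound (dist x) by exists 0 => _ [y _ <-].
have inf_le x : inf (dist x) <= n.+1%:R.
  by have [y By xy] := far x; apply: ge_inf => //; exists y; rewrite ?xy.
have inf0 : inf (dist 0) = n.+1%:R.
  apply/le_anti; rewrite inf_le /=; apply: lb_le_inf.
    by have [y By xy] := far 0; exists (l1dist 0 y)%:R; exists y.
  move=> _ [y /negP By <-]; rewrite ler_nat /l1dist sub0r l1normN.
  by rewrite ltnNge.
have ball0 : lattice_ball D n 0 by rewrite /lattice_ball /= l1norm0.
rewrite /inner_radius; apply/le_anti/andP; split.
  apply: ge_sup; first by exists (inf (dist 0)), 0.
  by move=> _ [x _ <-]; exact: inf_le.
apply: ub_le_sup; first by exists n.+1%:R => _ [x _ <-]; exact: inf_le.
by exists 0.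
Qed.

(** * Summation by parts *)

(** Shifting the summation variable by [s] turns the backward difference into a
    forward one, with a sign because [f] is odd. *)
Lemma summation_by_parts (R : realType) (V : zmodType) (f : R -> R)
    (u v : V -> R) (s : V) (A : set V) :
    {morph f : t / - t} -> finite_set A ->
    (forall x, (~` A) x -> v x = 0) -> (forall x, (~` A) x -> v (x + s) = 0) ->
  \sum_(x \in A) - (v x * (f (u (x + s) - u x) + f (u (x - s) - u x))) =
  \sum_(x \in A) f (u (x + s) - u x) * (v (x + s) - v x).
Proof.
move=> fN Afin vA vsA.
pose g x := v x * f (u (x - s) - u x).
have gE x : g (x + s) = - (v (x + s) * f (u (x + s) - u x)).
  by rewrite /g addrK -opprB fN mulrN.
have shift : \sum_(x \in A) g x = \sum_(x \in A) g (x + s).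
  rewrite (fsbig_widen A setT)//; last first.
    by move=> x [_ nAx] /=; rewrite /g vA// mul0r.
  rewrite (@reindex_fsbigT _ _ _ _ _ (fun x => x + s)); last first.
    by exists (fun x => x - s) => x; rewrite ?addrK ?subrK.
  rewrite [RHS](fsbig_widen A setT)// => x [_ nAx] /=.
  by rewrite gE vsA// mul0r oppr0.
have -> : \sum_(x \in A) f (u (x + s) - u x) * (v (x + s) - v x) =
    \sum_(x \in A) - (v x * f (u (x + s) - u x)) + \sum_(x \in A) - g (x + s).
  rewrite -fsbig_split//; apply: eq_fsbigr => x _ /=; rewrite gE; ring.
have -> : \sum_(x \in A) - g (x + s) = \sum_(x \in A) - g x.
  rewrite !fsbig_finite// in shift *; rewrite !sumrN; congr (- _).
  exact: esym shift.
rewrite -fsbig_split//; apply: eq_fsbigr => x _ /=; rewrite /g; ring.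
Qed.

Lemma out_ball_step (D n : nat) (k : 'I_D * bool) (x : 'rV[int]_D) :
  (~` lattice_ball D n.+1) x -> (~` lattice_ball D n) (x + lattice_step D k).
Proof.
rewrite /lattice_ball /= => nx xk; apply: nx.
rewrite -(addrK (lattice_step D k) x); apply: leq_trans (l1normD _ _ _) _.
by rewrite l1normN l1norm_step addn1 ltnS.
Qed.

(** The sum runs over the ball of radius [n + 1], which contains both endpoints
    of every edge on which [v] is not identically zero. *)
Lemma green_identity (R : realType) (D n : nat) (p : R) (u v : 'rV[int]_D -> R) :
    zero_outside (lattice_ball D n) v ->
  \sum_(x \in lattice_ball D n.+1) - (v x * pLaplacian p u x) =
  \sum_i \sum_(x \in lattice_ball D n.+1)
    flux p (u (x + delta_mx 0 i) - u x) * (v (x + delta_mx 0 i) - v x).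
Proof.
move=> v0; have ball_fin := @finite_lattice_ball D n.+1.
have sub : lattice_ball D n `<=` lattice_ball D n.+1.
  by move=> x /= xn; exact: leq_trans xn _.
under eq_fsbigr => x _.
  rewrite pLaplacianE -(pair_bigA _ (fun i b =>
    flux p (u (x + lattice_step D (i, b)) - u x))) /= mulr_sumr -sumrN.
  over.
rewrite fsbig_finite//= exchange_big /=; apply: eq_bigr => i _.
rewrite -(@summation_by_parts _ _ (flux p))//; first last.
- by move=> x /(out_ball_step _ _ (i, true)) /v0.
- by move=> x nx; apply: v0 => /sub.
- exact: fluxN.
by rewrite fsbig_finite//; apply: eq_bigr => x _; rewrite big_bool.
Qed.

(** * The capacity of the origin *)

(** The flux at the pole is the p-capacity of the origin, hence bounded by the
    energy of any competitor [v], up to a constant.  Testing the equation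
    against [u] and against [v] gives the same number, which is therefore both
    the energy of [u] and the pairing that [flux_young] controls.  The energy of
    [v] enters through its largest slope [delta] and the number of edges. *)
Lemma flux_at_pole_le (R : realType) (D n : nat) (p delta : R)
    (u v : 'rV[int]_D -> R) :
    2 < p -> zero_outside (lattice_ball D n) u -> u 0 = 1 ->
    (forall x, lattice_ball D n x -> x != 0 -> pLaplacian p u x = 0) ->
    zero_outside (lattice_ball D n) v -> v 0 = 1 ->
    (forall x i, `|v (x + delta_mx 0 i) - v x| <= delta) ->
  - pLaplacian p u 0 <=
    2 * (D%:R * ((2 * n.+1).+1%:R ^+ D * (2 * delta) `^ p)).
Proof.
move=> p2 u_out u0 u_harm v_out v0 v_lip.
have ball_fin := @finite_lattice_ball D n.+1.
have pole w : zero_outside (lattice_ball D n) w -> w 0 = 1 ->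
    - pLaplacian p u 0 =
    \sum_(x \in lattice_ball D n.+1) - (w x * pLaplacian p u x).
  move=> w_out w0; rewrite (fsbigD1 0)//=; last first.
    by rewrite /lattice_ball /= l1norm0.
  rewrite w0 mul1r fsbig1 ?addr0// => x [_ x0].
  have [xn|xn] := pselect (lattice_ball D n x).
    by rewrite u_harm ?mulr0 ?oppr0//; apply/eqP.
  by rewrite w_out// mul0r oppr0.
set M := - pLaplacian p u 0.
have Mu : M = _ := etrans (pole u u_out u0) (green_identity _ _ _ _ _ _ u_out).
have Mv : M = _ := etrans (pole v v_out v0) (green_identity _ _ _ _ _ _ v_out).
suff : M <= M / 2 + D%:R * ((2 * n.+1).+1%:R ^+ D * (2 * delta) `^ p) by lra.
(* The left-hand side is tested against [v], the energy term against [u]. *)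
rewrite {1}Mv {1}Mu mulr_suml.
have -> : D%:R * ((2 * n.+1).+1%:R ^+ D * (2 * delta) `^ p) =
    \sum_(i < D) (2 * n.+1).+1%:R ^+ D * (2 * delta) `^ p.
  by rewrite sumr_const card_ord mulr_natl.
rewrite -big_split /=; apply: ler_sum => i _.
apply: le_trans (lerD (lexx _) (sum_lattice_ball_le _ _ _ _ (powR_ge0 _ _))).
rewrite mulr_fsuml -fsbig_split//= !fsbig_finite//=; apply: ler_sum => x _.
apply: le_trans (flux_young _ _ p2 _ _) _; rewrite lerD2l.
have d0 : 0 <= delta := le_trans (normr_ge0 _) (v_lip 0 i).
apply: ge0_ler_powR; rewrite ?nnegrE ?mulr_ge0//; first by lra.
by rewrite ler_pM2l.
Qed.

Definition tent (R : realType) (D n : nat) (x : 'rV[int]_D) : R :=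
  Num.max 0 (1 - (l1norm x)%:R / n.+1%:R).

Lemma tent0 (R : realType) (D n : nat) : tent R D n 0 = 1.
Proof. by rewrite /tent l1norm0 mul0r subr0 max_r. Qed.

Lemma tent_out (R : realType) (D n : nat) :
  zero_outside (lattice_ball D n) (tent R D n).
Proof.
move=> x /negP; rewrite -ltnNge => nx; apply: max_l.
by rewrite subr_le0 ler_pdivlMr ?ltr0Sn// mul1r ler_nat.
Qed.

Lemma tent_lip (R : realType) (D n : nat) (x : 'rV[int]_D) (i : 'I_D) :
  `|tent R D n (x + delta_mx 0 i) - tent R D n x| <= n.+1%:R^-1.
Proof.
have h1 : ((l1norm (x + delta_mx 0 i))%:R <= (l1norm x)%:R + 1 :> R).
  rewrite natr1 ler_nat; apply: leq_trans (l1normD _ _ _) _.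
  by rewrite (l1norm_step _ (i, true)) addn1.
have h2 : ((l1norm x)%:R <= (l1norm (x + delta_mx 0 i))%:R + 1 :> R).
  rewrite natr1 ler_nat -{1}(addrK (delta_mx 0 i) x).
  apply: leq_trans (l1normD _ _ _) _.
  by rewrite l1normN (l1norm_step _ (i, true)) addn1.
rewrite /tent; set N : R := n.+1%:R^-1.
have N0 : 0 <= N by rewrite invr_ge0.
have {}h1 := ler_wpM2r N0 h1; have {}h2 := ler_wpM2r N0 h2.
rewrite mulrDl mul1r in h1; rewrite mulrDl mul1r in h2.
set a := _ * N in h1 h2 *; set b := (l1norm x)%:R * N in h1 h2 *.
rewrite ler_norml; apply/andP.
by case: (leP 0 (1 - a)) => ?; case: (leP 0 (1 - b)) => ?; split; lra.
Qed.

(** The equilibrium potential with its point mass, the tent being the competitor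
    that bounds the mass. *)
Lemma exists_small_potential (R : realType) (D n : nat) (p : R) : 2 < p ->
  exists w u : 'rV[int]_D -> R,
    [/\ forall x, lattice_ball D n x -> 0 <= w x,
        exists x, u x != 0,
        dirichlet_solution p (lattice_ball D n) w u
      & l1_on (lattice_ball D n) w <=
        2 * (D%:R * ((2 * n.+1).+1%:R ^+ D * (2 * n.+1%:R^-1) `^ p))].
Proof.
move=> p2; have ball0 : lattice_ball D n 0 by rewrite /lattice_ball /= l1norm0.
have [u [u01 u0 u_out u_harm]] := perron_solution R _ _
  (fun k x => x + lattice_step D k) (flux p) (lattice_ball D n) 0
  (flux_le _ _ p2) (flux0 _ _) (flux_continuous _ _ p2) ball0.
have {}u_harm x : lattice_ball D n x -> x != 0 -> pLaplacian p u x = 0.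
  by move=> xn x0; rewrite pLaplacianE; exact: u_harm.
have M_ge0 : 0 <= - pLaplacian p u 0.
  rewrite pLaplacianE -sumrN; apply: sumr_ge0 => k _.
  rewrite oppr_ge0 mulr_ge0_le0 ?powR_ge0// u0 subr_le0.
  by case/andP: (u01 (0 + lattice_step D k)).
pose w (x : 'rV[int]_D) := if x == 0 then - pLaplacian p u 0 else 0.
exists w, u; split.
- by move=> x _; rewrite /w; case: ifP.
- by exists 0; rewrite u0 oner_eq0.
- split=> // x xn; rewrite /w; case: eqP => [->|/eqP x0].
    by rewrite u0 normr1 powR1 !mulr1.
  by rewrite u_harm// oppr0 !mul0r.
- rewrite /l1_on (fsbigD1 0)//=; last exact: finite_lattice_ball.
  rewrite fsbig1 ?addr0 => [|x [_ /eqP /negPf x0]]; last by rewrite /w x0 normr0.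
  rewrite /w eqxx ger0_norm//.
  apply: (flux_at_pole_le _ _ _ _ _ _ (tent R D n)) => //.
  + exact: tent_out.
  + exact: tent0.
  + exact: tent_lip.
Qed.

Theorem proposition3p9 (R : realType) (D : nat) (hD : (2 <= D)%N)
    (p : R) (hp : D%:R < p) (beta : R) (hbeta : beta < p - D%:R)
    (C : R) (hC : 0 < C) :
  exists R0 : R, 1 < R0 /\
    forall n : nat, (0 < n)%N -> R0 <= n%:R ->
      exists w u : 'rV[int]_D -> R,
        [/\ (forall x, lattice_ball D n x -> 0 <= w x),
            (exists x, u x != 0),
            dirichlet_solution p (lattice_ball D n) w u
          & l1_on (lattice_ball D n) w
              < C / inner_radius R (lattice_ball D n) `^ beta].
Proof.
have p2 : 2 < p by apply: le_lt_trans hp; rewrite ler_nat.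
pose gamma := p - D%:R - beta.
have gamma0 : 0 < gamma by rewrite /gamma subr_gt0.
(* The bound on the norm is at most [K * (n + 1) ^ (D - p)], because
   [2 n + 3 <= 3 (n + 1)]. *)
pose K : R := 2 * (D%:R * (3 ^+ D * 2 `^ p)).
have K0 : 0 <= K by rewrite !mulr_ge0 ?exprn_ge0 ?powR_ge0.
(* Beyond this radius, [K < C * (n + 1) ^ gamma]. *)
exists (2 + (K / C) `^ gamma^-1); split.
  by have := powR_ge0 (K / C) gamma^-1; lra.
move=> n _ nR0; have [w [u [w_ge0 u_nz sol w_small]]] :=
  exists_small_potential R D n p p2.
exists w, u; split=> //; apply: le_lt_trans w_small _.
rewrite inner_radius_lattice_ball; last exact: leq_trans hD.
set N : R := n.+1%:R; have N0 : 0 < N by rewrite ltr0Sn.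
have N_ge0 := ltW N0.
have NR0 : (K / C) `^ gamma^-1 < N.
  by rewrite /N -natr1; lra.
apply: (@le_lt_trans _ _ (K * (N `^ D%:R * N `^ (- p)))).
  rewrite powRM ?invr_ge0// -(powR_inv1 N_ge0) -powRrM mulN1r powR_mulrn// /K.
  have -> : 2 * (D%:R * (3 ^+ D * 2 `^ p)) * (N ^+ D * N `^ (- p)) =
      2 * (D%:R * ((3 * N) ^+ D * (2 `^ p * N `^ (- p)))).
    by rewrite exprMn; ring.
  do 2!apply: ler_wpM2l => //.
  apply: ler_wpM2r; first by rewrite mulr_ge0 ?powR_ge0.
  rewrite lerXn2r ?nnegrE ?mulr_ge0// /N -natrM ler_nat; lia.
have NK : K / C < N `^ gamma.
  rewrite -[K / C]powRr1; last by rewrite divr_ge0// ltW.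
  rewrite -(mulVf (lt0r_neq0 gamma0)) powRrM.
  by apply: gt0_ltr_powR; rewrite ?nnegrE ?powR_ge0.
rewrite ltr_pdivrMr// in NK.
apply: (@lt_le_trans _ _ (N `^ gamma * C * (N `^ D%:R * N `^ (- p)))).
  by rewrite ltr_pM2r// mulr_gt0 ?powR_gt0.
rewrite -powRN -powRD; last by rewrite (lt0r_neq0 N0) implybT.
rewrite mulrAC -powRD; last by rewrite (lt0r_neq0 N0) implybT.
rewrite [_ * C]mulrC.
by have -> : gamma + (D%:R - p) = - beta by rewrite /gamma; ring.
Qed.
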